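(* Let $m,n$ be arbitrary non-negative integers. Let $(S,\cdot)$ be a Hausdorff semitopological semigroup which contains $\mathscr{C}_{m,n}$ as a dense subsemigroup, and suppose that $I=S\setminus\mathscr{C}_{m,n}\neq\varnothing$. Then $I$ is a two-sided ideal of the semigroup $S$.
   Context: The bicyclic monoid $\mathscr{C}(p,q)$ is the monoid with identity $1$ generated by two elements $p,q$ subject only to the relation $pq=1$. Each of its elements is written uniquely as $q^ip^j$ with $i,j\in\mathbb{N}_0$ (non-negative integers). For fixed $m,n\in\mathbb{N}_0$, $\mathscr{C}_{m,n}$ denotes the semigroup $(\mathscr{C}(p,q),\ast_{m,n})$ with the same underlying set and with operation $a\ast_{m,n}b=a\,q^mp^n\,b$ (product on the right taken in $\mathscr{C}(p,q)$). A semitopological semigroup is a topological space with a separately continuous semigroup operation. *)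

(* Defs.v *)
From HB Require Import structures.
From mathcomp Require Import all_boot all_order.
From mathcomp Require Import generic_quotient.
From mathcomp Require Import boolp classical_sets functions topology.

Set Implicit Arguments.
Unset Strict Implicit.
Unset Printing Implicit Defensive.

Local Open Scope classical_set_scope.
Local Open Scope group_scope.
Local Open Scope quotient_scope.

(* The bicyclic monoid < p, q | pq = 1 > is built from its presentation: the  *)
(* free monoid on two letters modulo the congruence generated by pq ~ 1.      *)
(* Letters are booleans, [true] standing for p and [false] for q.             *)
Definition bicyclic_word : Type := seq bool.

HB.instance Definition _ := Choice.on bicyclic_word.

Inductive bicyclic_cong : bicyclic_word -> bicyclic_word -> Prop :=
| bicyclic_cong_pq : bicyclic_cong [:: true; false] [::]
| bicyclic_cong_refl u : bicyclic_cong u u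
| bicyclic_cong_sym u v : bicyclic_cong u v -> bicyclic_cong v u
| bicyclic_cong_trans u v w :
    bicyclic_cong u v -> bicyclic_cong v w -> bicyclic_cong u w
| bicyclic_cong_cat u u' v v' :
    bicyclic_cong u u' -> bicyclic_cong v v' ->
    bicyclic_cong (u ++ v) (u' ++ v').

Definition bicyclic_eqv : rel bicyclic_word := fun u v => `[< bicyclic_cong u v >].

Lemma bicyclic_eqv_refl : reflexive bicyclic_eqv.
Proof. by move=> u; apply/asboolP; exact: bicyclic_cong_refl. Qed.

Lemma bicyclic_eqv_sym : symmetric bicyclic_eqv.
Proof.
by move=> u v; apply/asboolP/asboolP; exact: bicyclic_cong_sym.
Qed.

Lemma bicyclic_eqv_trans : transitive bicyclic_eqv.
Proof.
move=> v u w /asboolP uv /asboolP vw; apply/asboolP.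
exact: bicyclic_cong_trans uv vw.
Qed.

Canonical bicyclic_equiv :=
  EquivRel bicyclic_eqv bicyclic_eqv_refl bicyclic_eqv_sym bicyclic_eqv_trans.

Definition bicyclic : Type := {eq_quot bicyclic_eqv}.

HB.instance Definition _ := Choice.on bicyclic.
HB.instance Definition _ := EqQuotient.on bicyclic.

Definition bicyclic_mul (a b : bicyclic) : bicyclic :=
  \pi_bicyclic (repr a ++ repr b : bicyclic_word).

Lemma bicyclic_piP (u v : bicyclic_word) :
  \pi_bicyclic u = \pi_bicyclic v <-> bicyclic_cong u v.
Proof. by split=> [/eqmodP/asboolP|uv] //; apply/eqmodP/asboolP. Qed.

Lemma bicyclic_pi_cat (u v : bicyclic_word) :
  bicyclic_mul (\pi_bicyclic u) (\pi_bicyclic v) = \pi_bicyclic (u ++ v).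
Proof.
by apply/bicyclic_piP; apply: bicyclic_cong_cat; apply/bicyclic_piP; rewrite reprK.
Qed.

Lemma bicyclic_mulA : associative bicyclic_mul.
Proof.
move=> a b c; elim/quotW: a => u; elim/quotW: b => v; elim/quotW: c => w.
rewrite (bicyclic_pi_cat v w) (bicyclic_pi_cat u v).
by rewrite (bicyclic_pi_cat u) (bicyclic_pi_cat _ w) catA.
Qed.

Lemma bicyclic_mul1r : left_id (\pi_bicyclic [::]) bicyclic_mul.
Proof. by move=> a; elim/quotW: a => u; rewrite bicyclic_pi_cat. Qed.

Lemma bicyclic_mulr1 : right_id (\pi_bicyclic [::]) bicyclic_mul.
Proof. by move=> a; elim/quotW: a => u; rewrite bicyclic_pi_cat cats0. Qed.

HB.instance Definition _ := isSemigroup.Build bicyclic bicyclic_mulA.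
HB.instance Definition _ :=
  Semigroup_isMonoid.Build bicyclic bicyclic_mul1r bicyclic_mulr1.

Definition bicyclic_p : bicyclic := \pi_bicyclic [:: true].
Definition bicyclic_q : bicyclic := \pi_bicyclic [:: false].

Lemma bicyclic_pq : bicyclic_p * bicyclic_q = 1.
Proof. by rewrite [LHS]bicyclic_pi_cat; apply/bicyclic_piP/bicyclic_cong_pq. Qed.

(* A copy of the carrier of the bicyclic monoid, indexed by [m] and [n] so    *)
(* that it can carry the operation a q^m p^n b.                               *)
Definition bicyclic_variant (m n : nat) : Type := bicyclic.

HB.instance Definition _ m n := Choice.on (bicyclic_variant m n).

Definition bicyclic_variant_mul m n (a b : bicyclic_variant m n) :
    bicyclic_variant m n :=
  (a : bicyclic) * bicyclic_q ^+ m * bicyclic_p ^+ n * (b : bicyclic).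

Lemma bicyclic_variant_mulA m n : associative (@bicyclic_variant_mul m n).
Proof. by move=> a b c; rewrite /bicyclic_variant_mul !mulgA. Qed.

HB.instance Definition _ m n :=
  isSemigroup.Build (bicyclic_variant m n) (@bicyclic_variant_mulA m n).

HB.mixin Record isSemitopologicalSemigroup S of Topological S & Semigroup S := {
  mulgl_continuous : forall a : S, continuous (fun x : S => a * x);
  mulgr_continuous : forall a : S, continuous (fun x : S => x * a)
}.

#[short(type="semitopologicalSemigroupType")]
HB.structure Definition SemitopologicalSemigroup :=
  {S of Topological S & Semigroup S & isSemitopologicalSemigroup S}.

Definition two_sided_ideal (S : semigroupType) (I : set S) : Prop :=
  I !=set0 /\ forall s x : S, I x -> I (s * x) /\ I (x * s).

(* Main.v *)
Require Import Defs.
From HB Require Import structures.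
From mathcomp Require Import all_boot all_order.
From mathcomp Require Import boolp classical_sets functions topology.
From mathcomp Require Import generic_quotient cardinality zify.

Local Open Scope classical_set_scope.
Local Open Scope group_scope.

(** Write C for the image of C_(m,n) and I for its complement. In C, left
    multiplication by an element e with e q^m p^n = q^k p^k (such e exists as
    soon as n <= k) fixes exactly the q^a p^b with k <= a, and dually on the
    right. Since fixed point sets are
    closed, each point of C has an open neighbourhood in S meeting C in a finite
    set; by density such a neighbourhood lies inside C and is finite, so points
    of C are open in S. In the bicyclic monoid the equations a y = c and y a = c
    have finitely many solutions y. If a x = c with a, c in C and x in I, then
    {y | a y = c} is an open neighbourhood of x meeting C in a finite set, hence
    contained in C, a contradiction. If s x = c with both s and x in I, then by
    density some t in C satisfies t x = c, which was just excluded. *)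

(** The product of [q^a p^b] and [q^c p^d], as exponent pairs: truncated subtraction does the
    cancelling, since one of [c - b], [b - c] is always 0. *)
Definition exps_mul (x y : nat * nat) : nat * nat :=
  ((x.1 + (y.1 - x.2))%N, ((x.2 - y.1) + y.2)%N).

Lemma exps_mulA : associative exps_mul.
Proof. by case=> [a b] [c d] [e f]; rewrite /exps_mul /=; congr pair; lia. Qed.

Lemma exps_mul1 : left_id (0, 0)%N exps_mul.
Proof. by case=> [a b]; rewrite /exps_mul /=; congr pair; lia. Qed.

Definition word_exps (w : bicyclic_word) : nat * nat :=
  foldr (fun x => exps_mul (if x then (0, 1) else (1, 0))%N) (0, 0)%N w.

Lemma word_exps_cat (u v : bicyclic_word) :
  word_exps (u ++ v) = exps_mul (word_exps u) (word_exps v).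
Proof.
by elim: u => [|x u IHu] /=; rewrite ?exps_mul1// IHu exps_mulA.
Qed.

Lemma word_exps_cong (u v : bicyclic_word) :
  bicyclic_cong u v -> word_exps u = word_exps v.
Proof.
elim=> {u v} // [u v w _ -> _ ->//|u u' v v' _ uu' _ vv'].
by rewrite !word_exps_cat uu' vv'.
Qed.

Definition exps (x : bicyclic) : nat * nat := word_exps (repr x).

Lemma exps_pi (u : bicyclic_word) : exps (\pi_bicyclic%qT u) = word_exps u.
Proof. by apply: word_exps_cong; apply/bicyclic_piP; rewrite reprK. Qed.

Lemma expsM (x y : bicyclic) : exps (x * y) = exps_mul (exps x) (exps y).
Proof. by rewrite exps_pi word_exps_cat. Qed.

Lemma exps1 : exps 1 = (0, 0)%N.
Proof. by rewrite exps_pi. Qed.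

Lemma exps_qp (a b : nat) : exps (bicyclic_q ^+ a * bicyclic_p ^+ b) = (a, b).
Proof.
have qX : exps (bicyclic_q ^+ a) = (a, 0)%N.
  elim: a => [|a IHa]; first by rewrite expg0 exps1.
  by rewrite expgS expsM exps_pi IHa /exps_mul /=; congr pair; lia.
have pX : exps (bicyclic_p ^+ b) = (0, b)%N.
  elim: b => [|b IHb]; first by rewrite expg0 exps1.
  by rewrite expgS expsM exps_pi IHb /exps_mul /=; congr pair; lia.
by rewrite expsM qX pX /exps_mul /=; congr pair; lia.
Qed.

(** Induction on a word: a prepended q raises the first exponent; a prepended p cancels a leading q
    or, if there is none, joins the powers of p. *)
Lemma bicyclic_normal_form (x : bicyclic) :
  x = bicyclic_q ^+ (exps x).1 * bicyclic_p ^+ (exps x).2.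
Proof.
elim/quotW: x => u; rewrite exps_pi.
elim: u => [|x u IHu]; first by rewrite !expg0 mulg1.
have -> : \pi_bicyclic%qT (x :: u) = \pi_bicyclic%qT [:: x] * \pi_bicyclic%qT u.
  by rewrite [RHS]bicyclic_pi_cat.
rewrite {}IHu.
have -> : word_exps (x :: u) =
    exps_mul (if x then (0, 1) else (1, 0))%N (word_exps u) by [].
case: (word_exps u) => a b; case: x; rewrite /exps_mul /=; last first.
  by rewrite subn0 sub0n -[\pi_bicyclic%qT _]/bicyclic_q mulgA -expgS.
rewrite -[\pi_bicyclic%qT _]/bicyclic_p; case: a => [|a].
  by rewrite !expg0 !mul1g -expgS.
by rewrite expgS !mulgA bicyclic_pq mul1g add0n subn1.
Qed.

Lemma exps_inj : injective exps.
Proof.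
by move=> x y xy; rewrite (bicyclic_normal_form x) xy -bicyclic_normal_form.
Qed.

Lemma finite_exps_box (a b : nat) (A : set bicyclic) :
  (forall x, A x -> ((exps x).1 < a)%N /\ ((exps x).2 < b)%N) -> finite_set A.
Proof.
move=> Aab; apply: (@sub_finite_set _ _ (exps @^-1` (`I_a `*` `I_b))) => //.
by apply: finite_preimage; [move=> ? ? _ _; exact: exps_inj | exact: finite_setX].
Qed.

Section variant.
Context {m n : nat}.
Implicit Types a c x y : bicyclic_variant m n.

Lemma exps_variantM x y :
  exps (x * y) = exps_mul (exps_mul (exps x) (m, n)) (exps y).
Proof.
rewrite -[x * y]/((x : bicyclic) * bicyclic_q ^+ m * bicyclic_p ^+ n * (y : bicyclic)).
by rewrite expsM -mulgA expsM exps_qp.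
Qed.

Lemma finite_variant_mull a c : finite_set [set y | a * y = c].
Proof.
(* Multiplying by [a q^m p^n] cancels at most as many q's of [y] as that element has p's, and no p
   of [y]. *)
apply: (@finite_exps_box ((exps c).1 + ((exps a).2 - m) + n).+1 (exps c).2.+1).
by move=> y /= <-; rewrite exps_variantM /exps_mul /=; lia.
Qed.

Lemma finite_variant_mulr a c : finite_set [set y | y * a = c].
Proof.
apply: (@finite_exps_box (exps c).1.+1 ((exps c).2 + (exps a).1 + m).+1).
by move=> y /= <-; rewrite exps_variantM /exps_mul /=; lia.
Qed.

Definition qp_variant (a b : nat) : bicyclic_variant m n :=
  bicyclic_q ^+ a * bicyclic_p ^+ b.

(** The exponent [k - n + m] is chosen so that p^(k-n+m) q^m p^n = p^k, the subtraction being exact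
    for [n <= k]. *)
Lemma qp_variant_fixl (k : nat) x : (n <= k)%N ->
  qp_variant k (k - n + m) * x = x <-> (k <= (exps x).1)%N.
Proof.
move=> nk; split=> [/(congr1 (fun z => (exps z).1))|kx].
  by rewrite exps_variantM exps_qp /exps_mul /=; lia.
apply: exps_inj; rewrite exps_variantM exps_qp [RHS]surjective_pairing.
by rewrite /exps_mul /=; congr pair; lia.
Qed.

Lemma qp_variant_fixr (k : nat) x : (m <= k)%N ->
  x * qp_variant (k - m + n) k = x <-> (k <= (exps x).2)%N.
Proof.
move=> mk; split=> [/(congr1 (fun z => (exps z).2))|kx].
  by rewrite exps_variantM exps_qp /exps_mul /=; lia.
apply: exps_inj; rewrite exps_variantM exps_qp [RHS]surjective_pairing.
by rewrite /exps_mul /=; congr pair; lia.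
Qed.

End variant.

Lemma open_neq_fixed {T : topologicalType} (f : T -> T) :
  hausdorff_space T -> continuous f -> open [set x | f x <> x].
Proof.
rewrite open_hausdorff => T2 fc; rewrite openE => x /= /eqP /T2.
move=> [[A B] /= [/set_mem Afx /set_mem Bx] [oA oB /eqP AB0]].
have nA : nbhs x (f @^-1` A) by apply/fc/open_nbhs_nbhs.
have nB : nbhs x B by exact: open_nbhs_nbhs.
apply: filterS (filterI nA nB) => y [Afy By] fy.
have : (A `&` B) y by split=> //; rewrite -fy.
by rewrite AB0.
Qed.

(** The finite set [U] ∩ [D] is closed, so its complement in [U] is open; it misses [D], hence is
    empty. *)
Lemma dense_open_finite_sub {T : topologicalType} {D U : set T} :
  accessible_space T -> dense D -> open U -> finite_set (U `&` D) -> U `<=` D.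
Proof.
move=> /accessible_finite_set_closed T1 Dd oU /T1 UDcl x Ux.
apply: contrapT => Dx.
have [||y [[Uy UDy] Dy]] := Dd (U `&` ~` (U `&` D)).
- by exists x; split=> // -[].
- by apply: openI => //; exact: closed_openC.
- by apply: UDy.
Qed.

Lemma dense_open_finite_isolated {T : topologicalType} {D U : set T} {x : T} :
  accessible_space T -> dense D -> open U -> finite_set (U `&` D) -> U x ->
  open [set x].
Proof.
move=> T1 Dd oU UDfin Ux.
have UD := dense_open_finite_sub T1 Dd oU UDfin.
have Ufin : finite_set U by move: UDfin; rewrite setIidl.
have -> : [set x] = U `&` ~` (U `\ x).
  apply/seteqP; split=> [y -> /=|y /= [Uy Uxy]]; first by split=> // -[_]; apply.
  by apply: contrapT => yx; apply: Uxy.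
apply: openI => //; apply: closed_openC.
by move/accessible_finite_set_closed: T1; apply; exact: finite_setD.
Qed.

Section extension.
Context {m n : nat} {S : semitopologicalSemigroupType}.
Context {i : {multiplicative bicyclic_variant m n -> S}}.
Hypotheses (S_hausdorff : hausdorff_space S) (i_inj : injective i).
Hypothesis i_dense : dense (range i).

Lemma open_variant_point (x : bicyclic_variant m n) : open [set i x].
Proof.
(* The successors put [x] strictly inside the box of exponents below [k] and [l]; the summands [n]
   and [m] meet the bounds of the fixed point lemmas. *)
pose k := (n + (exps x).1.+1)%N; pose l := (m + (exps x).2.+1)%N.
pose e : bicyclic_variant m n := qp_variant k (k - n + m).
pose f : bicyclic_variant m n := qp_variant (l - m + n) l.
have fixe y : e * y = y <-> (k <= (exps y).1)%N.
  by apply: qp_variant_fixl; rewrite /k; lia.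
have fixf y : y * f = y <-> (l <= (exps y).2)%N.
  by apply: qp_variant_fixr; rewrite /l; lia.
pose U := [set s : S | i e * s <> s] `&` [set s : S | s * i f <> s].
have UiE y : U (i y) <-> ((exps y).1 < k)%N /\ ((exps y).2 < l)%N.
  rewrite /U /= -!gmulfM; split=> -[].
    move=> ey yf; rewrite !ltnNge; split; apply/negP.
      by move=> /fixe eyy; apply: ey; rewrite eyy.
    by move=> /fixf yfy; apply: yf; rewrite yfy.
  by rewrite !ltnNge => /negP yk /negP yl; split=> /i_inj => [/fixe|/fixf].
apply: (dense_open_finite_isolated (hausdorff_accessible S_hausdorff) i_dense _ (U := U)).
- by apply: openI; apply: open_neq_fixed => //;
    [exact: mulgl_continuous | exact: mulgr_continuous].
- apply: (@sub_finite_set _ _ (i @` [set y | U (i y)])).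
    by move=> t [Ut [y _ yt]]; exists y => //; rewrite /= yt.
  by apply/finite_image/(@finite_exps_box k l) => y /UiE.
- by apply/UiE; rewrite /k /l; lia.
Qed.

(** Stated for a general map with finite fibres on C, so that left and right translations are
    handled together. *)
Lemma finite_fibre_remainder (g : bicyclic_variant m n -> bicyclic_variant m n)
    (f : S -> S) (s : S) :
  continuous f -> (forall y, f (i y) = i (g y)) ->
  (forall c, finite_set [set y | g y = c]) ->
  (~` range i) s -> (~` range i) (f s).
Proof.
move=> fc fi gfin sI [c _ cfs]; apply: sI.
apply: (dense_open_finite_sub (U := f @^-1` [set i c])
  (hausdorff_accessible S_hausdorff) i_dense) => //=.
- by apply: open_comp; [move=> ? _; exact: fc | exact: open_variant_point].
- apply: sub_finite_set (finite_image i (gfin c)) => t [/= ft [y _ yt]].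
  by exists y => //=; apply: i_inj; rewrite -fi yt.
Qed.

Lemma range_mul_remainder (a s : S) : range i a -> (~` range i) s ->
  (~` range i) (a * s) /\ (~` range i) (s * a).
Proof.
move=> [b _ <-] sI; split.
  apply: (finite_fibre_remainder (fun y => b * y) (fun t => i b * t)) => //.
  - exact: mulgl_continuous.
  - by move=> y; rewrite gmulfM.
  - by move=> c; exact: finite_variant_mull.
apply: (finite_fibre_remainder (fun y => y * b) (fun t => t * i b)) => //.
- exact: mulgr_continuous.
- by move=> y; rewrite gmulfM.
- by move=> c; exact: finite_variant_mulr.
Qed.

(** If [f t = i c], the preimage of the open point [i c] is open and nonempty, so by density it
    contains a point of C, which [f] would send into C. *)
Lemma dense_preserves_remainder (f : S -> S) :
  continuous f -> (forall t, range i t -> (~` range i) (f t)) ->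
  forall t, (~` range i) (f t).
Proof.
move=> fc fI t [c _ cft].
have [||u [fu iu]] := i_dense (f @^-1` [set i c]).
- by exists t => /=.
- by apply: open_comp; [move=> ? _; exact: fc | exact: open_variant_point].
- by apply: (fI u iu); exists c.
Qed.

End extension.

Theorem theorem4 (m n : nat) (S : semitopologicalSemigroupType)
    (S_hausdorff : hausdorff_space S)
    (i : {multiplicative bicyclic_variant m n -> S})
    (i_inj : injective i)
    (i_dense : dense (range i))
    (I_neq0 : (~` range i) !=set0) :
  two_sided_ideal (~` range i).
Proof.
split=> // s x xI.
split.
  (* The factor in I stays fixed and the other one varies: the translation sends C into I, hence all
     of S. *)
  apply: (dense_preserves_remainder S_hausdorff i_inj i_dense (fun t => t * x)).
    exact: mulgr_continuous.
  by move=> t ti; exact: (range_mul_remainder S_hausdorff i_inj i_dense t x ti xI).1.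
apply: (dense_preserves_remainder S_hausdorff i_inj i_dense (fun t => x * t)).
  exact: mulgl_continuous.
by move=> t ti; exact: (range_mul_remainder S_hausdorff i_inj i_dense t x ti xI).2.
Qed.
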